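(* Let $\tau>0$, $\xi\in[t_0,t_0+\tau]$, $\eta\in\mathbb R^m$, and let $y(t)\equiv y(t,\xi,\eta,\phi;t_0)$ be the solution of $$\dot y(t)=f(y(t),y(t-\tau)),\quad t\in[t_0,t_0+\tau],\qquad y(\xi)=\eta,\qquad y(t)=\phi(t),\quad t\in[t_0-\tau,t_0).$$ Then $$a)\ \frac{\partial}{\partial t}y(t)=f(y(t),y(t-\tau)),\qquad b)\ \frac{\partial}{\partial\eta}y(t)=\Phi(t,\xi;t_0),\qquad c)\ \frac{\partial}{\partial\xi}y(t)=-\Phi(t,\xi;t_0)\,f(y(\xi),y(\xi-\tau)),$$ where $\Phi(t,\xi;t_0)\in\mathbb R^{m\times m}$ satisfies $$\dot\Phi(t,\xi;t_0)=F_1(y(t),y(t-\tau))\,\Phi(t,\xi;t_0),\quad t\in[t_0,t_0+\tau],$$ $$\Phi(\xi,\xi;t_0)=I,\qquad \Phi(t,\xi;t_0)=O\quad\text{for } t\in[t_0-\tau,t_0),$$ with $I$ and $O$ the identity and zero matrices in $\mathbb R^{m\times m}$.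
   Context: $f:\mathbb R^m\times\mathbb R^m\to\mathbb R^m$, $(z,w)\mapsto f(z,w)$, and $\phi:[t_0-\tau,t_0]\to\mathbb R^m$ are assumed suitably regular (as smooth as needed). $F_1(z,w)=\frac{\partial}{\partial z}f(z,w)$. The dot denotes differentiation in the first argument $t$. The function $\phi$ is the known memory term of the equation: for $t$ in $[t_0,t_0+\tau]$, $y(t-\tau)$ is given by $\phi(t-\tau)$. The condition $y(\xi)=\eta$ is given at the point $\xi$, and the solution is considered on the whole of $[t_0,t_0+\tau]$ (both to the left and to the right of $\xi$), where it is taken to be defined for every choice of $\xi\in[t_0,t_0+\tau]$. *)

(* Defs.v *)
From HB Require Import structures.
From mathcomp Require Import all_boot all_order all_algebra.
From mathcomp Require Import all_classical all_reals all_analysis.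
Import Order.TTheory GRing.Theory Num.Theory.
Import numFieldNormedType.Exports.

Set Implicit Arguments.
Unset Strict Implicit.
Unset Printing Implicit Defensive.

Local Open Scope classical_set_scope.
Local Open Scope ring_scope.

(* Derivative relative to A: two-sided at interior points of an interval A,
   one-sided at its endpoints. *)
Definition is_derive_within (R : realType) (V : normedModType R)
    (A : set R) (x : R) (u : R -> V) (du : V) : Prop :=
  (s - x)^-1 *: (u s - u x) @[s --> within A x^'] --> du.

(* Entry (i, j) is the partial derivative of the i-th component of f with
   respect to the j-th coordinate of z. *)
Definition F1 (R : realType) (m : nat)
    (f : 'cV[R]_m -> 'cV[R]_m -> 'cV[R]_m) (z w : 'cV[R]_m) : 'M[R]_m :=
  \matrix_(i, j) ('D_(delta_mx j ord0) (fun z' => f z' w) z) i ord0.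

(* f is continuous, and C^1 in its first argument with jointly continuous
   Jacobian. *)
Definition regular_rhs (R : realType) (m : nat)
    (f : 'cV[R]_m -> 'cV[R]_m -> 'cV[R]_m) : Prop :=
  [/\ continuous (fun p : 'cV[R]_m * 'cV[R]_m => f p.1 p.2),
      forall z w, differentiable (fun z' => f z' w) z &
      continuous (fun p : 'cV[R]_m * 'cV[R]_m => F1 f p.1 p.2)].

(* u solves u'(t) = f(u(t), u(t - tau)) on [t0, t0 + tau] with u(xi) = eta and
   memory phi. The delayed value is phi (t - tau) for every t in
   [t0, t0 + tau]; at t = t0 + tau it is phi t0, which in general differs from
   u t0, since u may jump at t0. *)
Definition dde_solution (R : realType) (m : nat)
    (f : 'cV[R]_m -> 'cV[R]_m -> 'cV[R]_m) (phi : R -> 'cV[R]_m)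
    (t0 tau xi : R) (eta : 'cV[R]_m) (u : R -> 'cV[R]_m) : Prop :=
  [/\ forall t, t \in `[t0, t0 + tau] ->
        is_derive_within `[t0, t0 + tau] t u (f (u t) (phi (t - tau))),
      u xi = eta &
      forall t, t \in `[t0 - tau, t0[ -> u t = phi t].

(* Phi is the matrix solution of the variational equation along u. *)
Definition variational_solution (R : realType) (m : nat)
    (f : 'cV[R]_m -> 'cV[R]_m -> 'cV[R]_m) (phi : R -> 'cV[R]_m)
    (t0 tau xi : R) (u : R -> 'cV[R]_m) (Phi : R -> 'M[R]_m) : Prop :=
  [/\ forall t, t \in `[t0, t0 + tau] ->
        is_derive_within `[t0, t0 + tau] t Phi
          (F1 f (u t) (phi (t - tau)) *m Phi t),
      Phi xi = 1%:M &
      forall t, t \in `[t0 - tau, t0[ -> Phi t = 0].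

(* Main.v *)
Require Import Defs.
From HB Require Import structures.
From mathcomp Require Import all_boot all_order all_algebra.
From mathcomp Require Import all_classical all_reals all_analysis.
From mathcomp Require Import ring lra.
Import Order.TTheory GRing.Theory Num.Theory.
Import numFieldNormedType.Exports.

Set Implicit Arguments.
Unset Strict Implicit.
Unset Printing Implicit Defensive.

Local Open Scope classical_set_scope.
Local Open Scope ring_scope.

(** Dependence of the solution on the condition y(xi) = eta.

    For t in [t0, t0 + tau] the delayed argument only meets the known memory,
    so y solves the ordinary differential equation u' = g(t, u) with
    g(t, z) = f(z, phi(t - tau)), and A(t) = F1(y(t), phi(t - tau)) is the
    Jacobian of g along y. Both derivatives come from one estimate
    ([first_order_perturbation]): if u is another solution, v solves v' = A v,
    and x is any point of the interval, then uniformly in t and x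

      |u(t) - y(t) - v(t)|
         <= const * (|u(x) - y(x) - v(x)| + o(|u(x) - y(x)|)).

    - Derivative in eta: take x = xi, u the solution with value eta + k at xi
      and v = Phi k. At x the difference u - y - v vanishes.
    - Derivative in xi: take u the solution with u(xi') = eta and compare at
      x = xi', not at xi, with v = -(xi' - xi) Phi f(eta, phi(xi - tau)). The
      value u(xi') is known there, and the difference u - y - v at xi' is
      o(|xi' - xi|) merely because y is differentiable at xi and Phi is
      continuous with Phi(xi) = I.

    The estimate is an inequality of Gronwall type for e = u - y, combined with
    the fact that the first-order expansion of g is uniform along the compact
    graph of y ([jacobian_linearization]). Since the expansion holds only near
    y, the Gronwall inequality ([gronwall]) is stated with a differential
    inequality assumed only while e is small. It and the mean value inequality
    both come from a barrier principle ([barrier]): a curve whose norm starts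
    below a scalar function can reach it only at a time where it moves at least
    as fast. No integral is used.

    Phi is obtained from the family of solutions itself rather than by Picard
    iteration: the difference quotients of y in the direction of a basis vector
    solve the variational equation up to an arbitrarily small error, and
    approximate solutions of a linear equation converge, by Gronwall, to an
    exact one ([linear_solution_of_approximate]). On [t0 - tau, t0) both
    derivatives vanish, as Phi does, because y is there equal to phi whatever
    xi and eta are. *)

(** * Derivatives relative to a set *)

Section derive_within.
Context {R : realType}.
Implicit Types (V W : normedModType R) (A : set R).

(** The form in which derivatives are used: it avoids dividing by s - x and
    needs no exception at s = x. *)
Lemma is_derive_withinP V A x (u : R -> V) du :
  is_derive_within A x u du <->
  forall e : R, 0 < e -> exists2 d : R, 0 < d & forall s, A s -> `|s - x| < d ->
    `|u s - u x - (s - x) *: du| <= e * `|s - x|.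
Proof.
have rescale s e : s != x ->
    (`|du - (s - x)^-1 *: (u s - u x)| <= e) =
    (`|u s - u x - (s - x) *: du| <= e * `|s - x|).
  rewrite -subr_eq0 => sx0.
  rewrite -{1}(scalerK sx0 du) -scalerBr normrZ normfV (distrC _ (u s - u x)).
  by rewrite mulrC ler_pdivrMr ?normr_gt0.
rewrite /is_derive_within cvgrPdist_le; split => H e e0.
  have := H e e0; rewrite !near_withinE => /nbhs_normP[d /= d0 dP].
  exists d => // s As sxd; have [->|sx] := eqVneq s x.
    by rewrite !subrr scale0r subr0 !normr0 mulr0.
  by rewrite -rescale//; apply: dP => //=; rewrite distrC.
have [d d0 dP] := H e e0.
rewrite !near_withinE; apply/nbhs_normP; exists d => //= s sd sx As.
by rewrite rescale//; apply: dP => //; rewrite distrC.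
Qed.

Lemma is_derive_within_subset V A B x (u : R -> V) du :
  A `<=` B -> is_derive_within B x u du -> is_derive_within A x u du.
Proof.
move=> AB /is_derive_withinP H; apply/is_derive_withinP => e /H[d d0 dP].
by exists d => // s /AB; exact: dP.
Qed.

Lemma is_derive_within_ext V A x (u v : R -> V) du :
  u =1 v -> is_derive_within A x u du -> is_derive_within A x v du.
Proof. by move=> /funext ->. Qed.

Lemma is_derive_within_eq V A x (u v : R -> V) du :
  A x -> {in A, u =1 v} -> is_derive_within A x u du ->
  is_derive_within A x v du.
Proof.
move=> Ax uv /is_derive_withinP H; apply/is_derive_withinP => e /H[d d0 dP].
exists d => // s As; rewrite -!uv ?inE//; exact: dP.
Qed.

Lemma is_derive_withinB V A x (u v : R -> V) du dv :
  is_derive_within A x u du -> is_derive_within A x v dv ->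
  is_derive_within A x (fun s => u s - v s) (du - dv).
Proof.
move=> hu hv; rewrite /is_derive_within.
under eq_fun do rewrite opprD addrACA -opprD scalerBr.
exact: cvgB.
Qed.

Lemma is_derive_withinD V A x (u v : R -> V) du dv :
  is_derive_within A x u du -> is_derive_within A x v dv ->
  is_derive_within A x (fun s => u s + v s) (du + dv).
Proof.
move=> hu hv; rewrite /is_derive_within.
under eq_fun do rewrite opprD addrACA scalerDr.
exact: cvgD.
Qed.

Lemma is_derive_within_linear V W (L : {linear V -> W}) A x (u : R -> V) du :
  continuous L -> is_derive_within A x u du ->
  is_derive_within A x (fun s => L (u s)) (L du).
Proof.
move=> cL hu; rewrite /is_derive_within.
under eq_fun do rewrite -linearB -linearZ/=.
by apply: continuous_cvg => //; exact: cL.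
Qed.

Lemma is_derive_within_affine V A x (a b : V) :
  is_derive_within A x (fun s => a + s *: b) b.
Proof.
apply/is_derive_withinP => e e0; exists 1 => // s _ _.
by rewrite opprD addrACA subrr add0r -scalerBl subrr normr0 mulr_ge0// ltW.
Qed.

Lemma is_derive_within_comp_affine V A (sg x : R) (u : R -> V) s du :
  is_derive_within A (x + sg * s) u du ->
  is_derive_within [set r | A (x + sg * r)] s (fun r => u (x + sg * r))
    (sg *: du).
Proof.
move=> /is_derive_withinP H; apply/is_derive_withinP => e e0.
have g0 : 0 < `|sg| + 1 by rewrite ltr_wpDl.
have [d d0 dP] := H (e / (`|sg| + 1)) (divr_gt0 e0 g0).
exists (d / (`|sg| + 1)); first exact: divr_gt0.
move=> r Ar rs.
have E : x + sg * r - (x + sg * s) = sg * (r - s) by ring.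
have := dP _ Ar; rewrite E scalerA mulrC.
rewrite (mulrC (r - s)) => /(_ _)/le_trans; apply.
  rewrite normrM (le_lt_trans (y := (`|sg| + 1) * `|r - s|))//.
    by rewrite ler_wpM2r// lerDl.
  by rewrite mulrC -ltr_pdivlMr.
rewrite -mulrA ler_wpM2l ?(ltW e0)// ler_pdivrMl// normrM.
by rewrite ler_wpM2r// lerDl.
Qed.

Lemma is_derive_within_dist_le V A x (u : R -> V) du : A x ->
  is_derive_within A x u du ->
  forall e : R, 0 < e -> exists2 d : R, 0 < d & forall s, A s -> `|s - x| < d ->
    `|u s - u x| <= e.
Proof.
move=> Ax /is_derive_withinP/(_ 1 ltr01)[d d0 dP] e e0.
have g0 : 0 < `|du| + 1 by rewrite ltr_wpDl.
exists (Num.min d (e / (`|du| + 1))).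
  by rewrite lt_min d0 divr_gt0.
move=> s As; rewrite lt_min => /andP[sd se].
have := dP s As sd; rewrite mul1r => H.
rewrite -[u s - u x](subrK ((s - x) *: du)).
apply: le_trans (ler_normD _ _) _; rewrite normrZ.
apply: le_trans (lerD H (lexx _)) _.
by move: se; rewrite ltr_pdivlMr// mulrDr mulr1 addrC => /ltW.
Qed.

End derive_within.

(** * The barrier principle and its consequences *)

Section barrier.
Context {R : realType}.
Implicit Types (V : normedModType R).

Lemma exists_left_near (t d : R) : 0 < t -> 0 < d ->
  exists r, [/\ 0 <= r, r < t & `|r - t| < d].
Proof.
move=> t0 d0; have m0 : 0 < Num.min t d by rewrite lt_min t0.
have [mt md] : Num.min t d <= t /\ Num.min t d <= d.
  by rewrite !ge_min !lexx orbT.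
exists (t - Num.min t d / 2); split; [lra|lra|].
by rewrite addrAC subrr add0r normrN gtr0_norm; lra.
Qed.

(** At the first time t where e meets b, the increments of e over [r, t] have
    norm larger than those of b for every r < t, so |e'| >= b' at t. Only left
    derivatives matter, hence the one-sided form on [0, c]. *)
Lemma barrier_forward V (c : R) (e de : R -> V) (b db : R -> R) :
  `|e 0| < b 0 ->
  (forall s, 0 <= s <= c -> is_derive_within `[0, c] s e (de s)) ->
  (forall s, 0 <= s <= c -> is_derive_within (V := R^o) `[0, c] s b (db s)) ->
  (forall s, 0 <= s <= c -> `|e s| = b s -> `|de s| < db s) ->
  forall s, 0 <= s <= c -> `|e s| < b s.
Proof.
move=> e0 e_der b_der cross s sc; apply: contrapT => /negP; rewrite -leNgt.
move=> bes.
have inI r : 0 <= r <= c -> `[0, c]%classic r by rewrite /= in_itv.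
have gap r : 0 <= r <= c -> forall k : R, 0 < k -> exists2 d : R, 0 < d &
    forall r', 0 <= r' <= c -> `|r' - r| < d ->
    `|(b r' - `|e r'|) - (b r - `|e r|)| <= k.
  move=> rc k k0; have k20 : 0 < k / 2 by lra.
  have [d d0 dP] := is_derive_within_dist_le (inI _ rc) (e_der _ rc) k20.
  have [d' d'0 d'P] := is_derive_within_dist_le (inI _ rc) (b_der _ rc) k20.
  exists (Num.min d d'); first by rewrite lt_min d0.
  move=> r' r'c; rewrite lt_min => /andP[r'd r'd'].
  have /= H1 := dP _ (inI _ r'c) r'd; have /= H2 := d'P _ (inI _ r'c) r'd'.
  have := le_trans (ler_dist_dist _ _) H1.
  by move: H2; rewrite !ler_norml; lra.
pose S := [set r | 0 <= r <= c /\ b r <= `|e r|].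
have S_inf : has_inf S.
  by split; [exists s | exists 0 => r [/andP[]]].
pose t := inf S.
have tS r : S r -> t <= r by move=> Sr; apply: ge_inf => //; case: S_inf.
have t0 : 0 <= t by apply: lb_le_inf; [case: S_inf | move=> r [/andP[]]].
have tc : 0 <= t <= c.
  by rewrite t0 (le_trans (tS s _))//; case/andP: sc.
have St : b t <= `|e t|.
  rewrite leNgt; apply/negP => et.
  have k0 : 0 < (b t - `|e t|) / 2 by lra.
  have [d d0 dP] := gap _ tc _ k0.
  have [r [rc er] rd] := inf_adherent d0 S_inf.
  have tr := tS r (conj rc er).
  have : `|r - t| < d by rewrite ger0_norm; rewrite -/t in rd; lra.
  by move=> /(dP _ rc); rewrite ler_norml; lra.
have t_gt0 : 0 < t.
  by rewrite lt_neqAle t0 andbT; apply/eqP => t00; move: St; rewrite -t00; lra.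
have before r : 0 <= r -> r < t -> `|e r| < b r.
  move=> r0 rt; rewrite ltNge; apply/negP => er.
  by have := tS r; rewrite /S /= r0 => /(_ (conj _ er)); case/andP: tc; lra.
have touch : `|e t| = b t.
  apply/eqP; rewrite eq_le St andbT leNgt; apply/negP => et.
  have k0 : 0 < (`|e t| - b t) / 2 by lra.
  have [d d0 dP] := gap _ tc _ k0.
  have [r [r0 rt rd]] := exists_left_near t_gt0 d0.
  have rc : 0 <= r <= c by rewrite r0; case/andP: tc; lra.
  by have := before r r0 rt; have := dP r rc rd; rewrite ler_norml; lra.
have k0 := cross t tc touch.
(* A third, because both difference quotients at t are known up to k only. *)
pose k := (db t - `|de t|) / 3.
have k_gt0 : 0 < k by rewrite /k; lra.
have [d d0 dP] := (is_derive_withinP _ _ _ _).1 (e_der _ tc) k k_gt0.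
have [d' d'0 d'P] := (is_derive_withinP _ _ _ _).1 (b_der _ tc) k k_gt0.
have m0 : 0 < Num.min d d' by rewrite lt_min d0.
have [r [r0 rt]] := exists_left_near t_gt0 m0.
rewrite lt_min => /andP[rd rd'].
have rc : 0 <= r <= c by rewrite r0; case/andP: tc; lra.
have /= := d'P _ (inI _ rc) rd'; have /= := dP _ (inI _ rc) rd.
have -> : `|r - t| = t - r by rewrite distrC gtr0_norm; lra.
set q := e r - _ - _ => q_le; rewrite ler_norml => /andP[_ b_le].
have er := before _ r0 rt.
have et : `|e t| <= `|e r| + (t - r) * `|de t| + k * (t - r).
  have -> : e t = e r - q + (t - r) *: de t.
    rewrite -(opprB r t) scaleNr /q.
    by rewrite (opprB _ (_ *: _)) addrA addrAC addrK subKr.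
  apply: le_trans (ler_normD _ _) _.
  rewrite normrZ gtr0_norm; last by lra.
  by have := ler_normB (e r) q; lra.
rewrite /GRing.scale /= in b_le.
have kE : db t = `|de t| + 3 * k by rewrite /k; field.
have rk : 0 < (t - r) * k by rewrite mulr_gt0//; lra.
move: b_le; rewrite kE; nra.
Qed.

End barrier.

Section two_sided.
Context {R : realType}.
Implicit Types (V W : normedModType R).

(** The point x is the value of the line at r = s, so that the parameter s can
    be any real number. *)
Lemma is_derive_within_line V W (A : set R) s (F : V -> W) x v dF :
  is_derive x v F dF ->
  is_derive_within A s (fun r => F (x + (r - s) *: v)) dF.
Proof.
move=> F_der.
have : h^-1 *: ((F \o shift x) (h *: v) - F x) @[h --> 0^'] --> dF.
  by rewrite -(derive_val (is_derive := F_der)); exact: ex_derive.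
rewrite /is_derive_within subrr scale0r addr0 => /cvgrPdist_le H.
apply/cvgrPdist_le => e /H.
rewrite !near_withinE => /nbhs_normP[d /= d0 dP].
apply/nbhs_normP; exists d => //= r rs rs0 _.
have := dP (r - s); rewrite /= sub0r normrN distrC => /(_ rs).
by rewrite subr_eq0 (addrC _ x); exact.
Qed.

Lemma is_derive_is_derive_within (A : set R) (b : R -> R) (s db : R) :
  is_derive s 1 b db -> is_derive_within (V := R^o) A s b db.
Proof.
move=> /(@is_derive_within_line R^o R^o A s).
by under eq_fun do rewrite [_ *: 1]mulr1 addrC subrK.
Qed.

Lemma is_derive_within_cst V (A : set R) x (a : V) :
  is_derive_within A x (fun=> a) 0.
Proof.
have := @is_derive_within_affine _ _ A x a 0.
by under eq_fun do rewrite scaler0 addr0.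
Qed.

Lemma is_derive_within_sum V (A : set R) x n (u : 'I_n -> R -> V) du :
  (forall j, is_derive_within A x (u j) (du j)) ->
  is_derive_within A x (fun s => \sum_j u j s) (\sum_j du j).
Proof.
move=> u_der; elim: (index_enum 'I_n) => [|j l IHl].
  rewrite big_nil; apply: (is_derive_within_ext (u := fun=> 0)) => [s|].
    by rewrite big_nil.
  exact: is_derive_within_cst.
rewrite big_cons.
apply: (is_derive_within_ext (u := fun s => u j s + \sum_(i <- l) u i s)).
  by move=> s; rewrite big_cons.
exact: is_derive_withinD.
Qed.

(** Both sides of x follow from the forward case along r |-> x + r and
    r |-> x - r. *)
Lemma barrier V (p q x : R) (e de : R -> V) (b db : R -> R) :
  p <= x <= q -> `|e x| < b 0 ->
  (forall t, p <= t <= q -> is_derive_within `[p, q] t e (de t)) ->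
  (forall s : R, is_derive s 1 b (db s)) ->
  (forall t, p <= t <= q ->
     `|e t| = b `|t - x| -> `|de t| < db `|t - x|) ->
  forall t, p <= t <= q -> `|e t| < b `|t - x|.
Proof.
move=> xpq ex e_der b_der cross t tpq.
pose sg : R := if x <= t then 1 else -1.
have sgt : x + sg * `|t - x| = t.
  rewrite /sg; case: leP => xt; first by rewrite ger0_norm; lra.
  by rewrite ltr0_norm; lra.
have sg1 : `|sg| = 1 by rewrite /sg; case: ifP; rewrite ?normrN normr1.
have path s : 0 <= s <= `|t - x| -> p <= x + sg * s <= q.
  move: tpq xpq; rewrite /sg; case: (leP x t) => xt /andP[? ?] /andP[? ?] /andP[s0].
    by rewrite ger0_norm; lra.
  by rewrite ltr0_norm; lra.
have dist s : 0 <= s <= `|t - x| -> `|x + sg * s - x| = s.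
  by move=> /andP[s0 _]; rewrite addrAC subrr add0r normrM sg1 mul1r ger0_norm.
rewrite -{1}sgt; have := @barrier_forward _ _ `|t - x|
  (fun s => e (x + sg * s)) (fun s => sg *: de (x + sg * s)) b db.
apply; rewrite ?mulr0 ?addr0 ?normr_ge0 ?lexx//.
- move=> s sc; have /is_derive_within_comp_affine := e_der _ (path _ sc).
  by apply: is_derive_within_subset => r /=; rewrite !in_itv; exact: path.
- by move=> s sc; exact: is_derive_is_derive_within.
- move=> s sc es; rewrite normrZ sg1 mul1r.
  by have := cross _ (path _ sc); rewrite dist//; exact.
Qed.

(** The barriers are affine functions of slope slightly larger than M. *)
Lemma mean_value_inequality V (p q x M : R) (e de : R -> V) :
  p <= x <= q ->
  (forall t, p <= t <= q -> is_derive_within `[p, q] t e (de t)) ->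
  (forall t, p <= t <= q -> `|de t| <= M) ->
  forall t, p <= t <= q -> `|e t - e x| <= M * `|t - x|.
Proof.
move=> xpq e_der de_le t tpq; apply/ler_addgt0Pr => k k0.
have c0 : 0 < `|t - x| + 1 by rewrite ltr_wpDl.
(* Chosen so that the excess h + |t - x| h of the barrier is k. *)
pose h := k / (`|t - x| + 1); have h0 : 0 < h by exact: divr_gt0.
have := @barrier V p q x (fun t => e t - e x) de
  (fun s => h + s * (M + h)) (fun=> M + h) xpq.
rewrite subrr normr0 mul0r addr0 => /(_ h0) H.
suff : `|e t - e x| < h + `|t - x| * (M + h).
  have : h * (`|t - x| + 1) = k by rewrite divfK// gt_eqF.
  by move=> <- /ltW/le_trans; apply; lra.
apply: H => //.
- move=> s spq; rewrite -[de s]subr0; apply: is_derive_withinB (e_der _ spq) _.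
  exact: is_derive_within_cst.
- by move=> s; apply: is_derive_eq; rewrite add0r mul1r scaler0 add0r [_ *: 1]mulr1.
- by move=> s spq _; rewrite (le_lt_trans (de_le _ spq))// ltrDl.
Qed.

(** The differential inequality is only required while |e| <= r, and the strict
    bound on the exponential guarantees that e never leaves this region. The
    barriers are b s = (d + eps + h) exp ((L + 1) s) with h > 0 small: the
    additional 1 in the exponent gives b' = L b + b > L b + eps, which absorbs
    eps without a division by L. *)
Lemma gronwall V (p q x L d eps r : R) (e de : R -> V) :
  p <= x <= q -> 0 <= L -> 0 <= eps -> `|e x| <= d ->
  (d + eps) * expR ((L + 1) * (q - p)) < r ->
  (forall t, p <= t <= q -> is_derive_within `[p, q] t e (de t)) ->
  (forall t, p <= t <= q -> `|e t| <= r -> `|de t| <= L * `|e t| + eps) ->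
  forall t, p <= t <= q -> `|e t| <= (d + eps) * expR ((L + 1) * (q - p)).
Proof.
move=> xpq L0 eps0 exd dr e_der de_le t tpq; apply/ler_addgt0Pr => k k0.
set E := expR _ in dr *.
have E0 : 0 < E by exact: expR_gt0.
have d0 : 0 <= d by exact: le_trans exd.
pose h := Num.min k (r - (d + eps) * E) / E.
have h0 : 0 < h by rewrite divr_gt0// lt_min k0 subr_gt0.
have hE : h * E = Num.min k (r - (d + eps) * E) by rewrite divfK// gt_eqF.
have hk : h * E <= k /\ h * E <= r - (d + eps) * E.
  by rewrite hE !ge_min !lexx orbT.
pose b s := (d + eps + h) * expR ((L + 1) * s).
have b_le s : p <= s <= q -> b `|s - x| <= (d + eps + h) * E.
  move=> spq; rewrite /b ler_wpM2l//; first by lra.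
  rewrite ler_expR ler_wpM2l//; first by lra.
  by rewrite ler_norml; move: spq xpq => /andP[? ?] /andP[? ?]; lra.
suff : `|e t| < b `|t - x|.
  by have := b_le _ tpq; lra.
apply: (@barrier V p q x e de b (fun s => (L + 1) * b s)) => //.
- by rewrite /b mulr0 expR0; lra.
- move=> s; rewrite /b.
  apply: is_derive_eq.
  by rewrite /GRing.scale /=; ring.
- move=> s spq es; have bs := b_le _ spq.
  apply: le_lt_trans (de_le s spq _) _; first by rewrite es; lra.
  rewrite es; suff : d + eps + h <= b `|s - x| by lra.
  rewrite /b ler_peMr//; first by lra.
  by rewrite -[leLHS]expR0 ler_expR mulr_ge0//; lra.
Qed.

End two_sided.

(** * Linear maps and the Jacobian in coordinates *)

Section matrix.
Context {R : realType}.

Lemma mx_entry_le m n (A : 'M[R]_(m, n)) i j : `|A i j| <= `|A|.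
Proof.
rewrite [leRHS]/Num.norm /= mx_normrE.
by apply/bigmax_geP; right; exists (i, j).
Qed.

Lemma mx_norm_le m n (A : 'M[R]_(m, n)) (c : R) :
  0 <= c -> (forall i j, `|A i j| <= c) -> `|A| <= c.
Proof.
move=> c0 Ac; rewrite [leLHS]/Num.norm /= mx_normrE.
by apply/bigmax_leP; split => // -[i j] _; exact: Ac.
Qed.

Lemma mulmx_norm_le m n p (A : 'M[R]_(m, n)) (B : 'M[R]_(n, p)) :
  `|A *m B| <= n%:R * `|A| * `|B|.
Proof.
apply: mx_norm_le => [|i j]; first by rewrite !mulr_ge0.
rewrite mxE (le_trans (ler_norm_sum _ _ _))//.
apply: (@le_trans _ _ (\sum_(k < n) `|A| * `|B|)).
  by apply: ler_sum => k _; rewrite normrM ler_pM// mx_entry_le.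
by rewrite sumr_const card_ord -mulrA mulr_natl.
Qed.

Lemma lipschitz_linear_continuous (V W : normedModType R)
    (L : {linear V -> W}) (c : R) :
  (forall v, `|L v| <= c * `|v|) -> continuous L.
Proof.
move=> Lc; apply/linear_bounded_continuous/linear_boundedP.
exists c; split; first exact: num_real.
by move=> r /ltW cr v; apply: le_trans (Lc v) _; rewrite ler_wpM2r.
Qed.

Lemma is_diff_of_bound (V W : normedModType R) (F : V -> W)
    (L : {linear V -> W}) x :
  continuous L ->
  (forall e : R, 0 < e ->
     \forall k \near (0 : V), `|F (x + k) - F x - L k| <= e * `|k|) ->
  is_diff x F L.
Proof.
move=> cL F_le.
have FE : F \o shift x = cst (F x) + L +o_ 0 id.
  apply/eqaddoP => e /F_le; apply: filterS => k /=.
  by rewrite /cst /= !fctE opprD addrA (addrC k).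
have dE := diff_unique cL FE.
by apply: DiffDef => //; apply/diff_locallyP; rewrite dE.
Qed.

Lemma continuous_mulmx m n p (A : 'M[R]_(m, n)) :
  continuous (mulmx A : 'M[R]_(n, p) -> 'M[R]_(m, p)).
Proof.
apply: (lipschitz_linear_continuous (c := n%:R * `|A|)) => B.
exact: mulmx_norm_le.
Qed.

Lemma continuous_mulmxr m n p (B : 'M[R]_(n, p)) :
  continuous (mulmxr B : 'M[R]_(m, n) -> 'M[R]_(m, p)).
Proof.
apply: (lipschitz_linear_continuous (c := n%:R * `|B|)) => A /=.
by rewrite mulrAC; exact: mulmx_norm_le.
Qed.

Lemma diff_F1 m (f : 'cV[R]_m -> 'cV[R]_m -> 'cV[R]_m) z w v :
  differentiable (fun z' => f z' w) z ->
  'd (fun z' => f z' w) z v = F1 f z w *m v.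
Proof.
move=> df; have {1}-> : v = \sum_j v j ord0 *: delta_mx j ord0.
  by rewrite {1}(matrix_sum_delta v); apply: eq_bigr => j _; rewrite big_ord1.
rewrite linear_sum; apply/matrixP => i k; rewrite (ord1 k) summxE mxE.
by apply: eq_bigr => j _; rewrite linearZ /F1 !mxE deriveE// mulrC.
Qed.

End matrix.

(** * Uniform linearization along a curve *)

Section linearization.
Context {R : realType}.

Lemma is_derive_within_continuous (V : normedModType R) (A : set R)
    (u du : R -> V) :
  (forall t, A t -> is_derive_within A t u (du t)) -> {within A, continuous u}.
Proof.
move=> u_der; apply/subspace_continuousP => t At; apply/cvgrPdist_le => e e0.
have [d d0 dP] := is_derive_within_dist_le At (u_der t At) e0.
rewrite near_withinE; apply/nbhs_normP; exists d => //= s sd As.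
by rewrite distrC dP// distrC.
Qed.

Lemma continuous_along (V : topologicalType) (U W : topologicalType)
    (G : U -> V -> W) (A : set R) (u : R -> U) (w : R -> V) :
  continuous (fun z : U * V => G z.1 z.2) ->
  {within A, continuous u} -> {within A, continuous w} ->
  {within A, continuous (fun t => G (u t) (w t))}.
Proof.
move=> cG /subspace_continuousP cu /subspace_continuousP cw.
apply/subspace_continuousP => t At.
apply: (@continuous_cvg _ _ _ _ _ (fun s => (u s, w s))
  (fun z => G z.1 z.2) (u t, w t)); first exact: cG.
by apply: cvg_pair; [exact: cu|exact: cw].
Qed.

(** Continuity of a two-variable function on a neighbourhood of the graph of a
    curve over a segment is uniform because the segment is compact. *)
Lemma uniform_continuous_along (U V W : normedModType R) (G : U -> V -> W)
    (p q : R) (u : R -> U) (w : R -> V) :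
  continuous (fun z : U * V => G z.1 z.2) ->
  {within `[p, q], continuous u} -> {within `[p, q], continuous w} ->
  forall e : R, 0 < e -> exists2 r : R, 0 < r &
    forall t z, p <= t <= q -> `|z - u t| <= r ->
    `|G z (w t) - G (u t) (w t)| <= e.
Proof.
move=> cG cu' cw' e e0.
have /subspace_continuousP cu := cu'.
have /subspace_continuousP cw := cw'.
have /subspace_continuousP cGuw := continuous_along cG cu' cw'.
have e20 : 0 < e / 2 by lra.
have /compact_near_coveringP/near_covering_withinP cover :=
  @segment_compact R p q.
have : \forall h \near (0 : U), `[p, q] `<=` [set t |
    `|G (u t + h) (w t) - G (u t) (w t)| <= e].
  apply: cover => t tpq.
  have G1 : G (u s.1 + s.2) (w s.1)
      @[s --> filter_prod (within `[p, q] (nbhs t)) (nbhs (0 : U))]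
      --> G (u t) (w t).
    apply: (@continuous_cvg _ _ _ _ _ (fun s => (u s.1 + s.2, w s.1))
      (fun z => G z.1 z.2) (u t, w t)); first exact: cG.
    apply: cvg_pair.
      rewrite -[u t in X in _ --> X]addr0; apply: cvgD; last exact: cvg_snd.
      by apply: (cvg_comp fst u); [exact: cvg_fst|exact: cu].
    by apply: (cvg_comp fst w); [exact: cvg_fst|exact: cw].
  have G0 : G (u s) (w s) @[s --> within `[p, q] (nbhs t)] --> G (u t) (w t).
    exact: cGuw.
  have /cvgrPdist_le/(_ _ e20) [[Q1 Q2] [/= Q1t Q20] Q12] := G1.
  have /cvgrPdist_le/(_ _ e20) Q3 := G0.
  near=> s h => /= spq.
  have := ler_normB (G (u t) (w t) - G (u s) (w s))
    (G (u t) (w t) - G (u s + h) (w s)).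
  rewrite opprB addrC addrA subrK => /le_trans; apply.
  rewrite [leRHS]splitr lerD//.
    by move: spq; near: s; rewrite -near_withinE.
  apply: (Q12 (s, h)); split => /=; last by near: h.
  by move: spq; near: s; rewrite -near_withinE.
move=> /nbhs_normP[r /= r0 rP]; exists (r / 2); first by lra.
move=> t z tpq zr.
have := rP (z - u t) _ t tpq; rewrite /= (addrC (u t)) subrK; apply.
by rewrite sub0r normrN; apply: le_lt_trans zr _; lra.
Unshelve. all: by end_near. Qed.

End linearization.

Section jacobian_along.
Context {R : realType} {m : nat}.

(** On the segment from u t to z, the derivative of
    s |-> f (u t + s k) (w t) - s F1 k, with k = z - u t, is small as soon as z
    is close to u t, uniformly in t. *)
Lemma jacobian_linearization (f : 'cV[R]_m -> 'cV[R]_m -> 'cV[R]_m)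
    (p q : R) (u w : R -> 'cV[R]_m) :
  regular_rhs f ->
  {within `[p, q], continuous u} -> {within `[p, q], continuous w} ->
  forall e : R, 0 < e -> exists2 r : R, 0 < r &
    forall t z, p <= t <= q -> `|z - u t| <= r ->
    `|f z (w t) - f (u t) (w t) - F1 f (u t) (w t) *m (z - u t)|
      <= e * `|z - u t|.
Proof.
move=> [_ f_diff cF1] cu cw e e0.
have m0 : 0 < m%:R + 1 :> R by rewrite ltr_wpDl.
have [r r0 rP] := uniform_continuous_along cF1 cu cw (divr_gt0 e0 m0).
exists r => // t z tpq zr; set a := u t; set k := z - a.
set J := F1 f a (w t).
pose h (s : R) := f (a + s *: k) (w t) - s *: (J *m k).
pose dh (s : R) := F1 f (a + s *: k) (w t) *m k - J *m k.
have h_der s : 0 <= s <= 1 -> is_derive_within `[0, 1] s h (dh s).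
  move=> _; apply: is_derive_withinB; last first.
    apply: (is_derive_within_ext (u := fun r' => 0 + r' *: (J *m k))) => [r'|].
      by rewrite add0r.
    exact: is_derive_within_affine.
  apply: (is_derive_within_ext (u := fun r' =>
      f (a + s *: k + (r' - s) *: k) (w t))) => [r'|].
    by rewrite -addrA -scalerDl [s + _]addrC subrK.
  apply: (@is_derive_within_line _ _ _ _ s (fun z => f z (w t))).
  have f_diff_s := f_diff (a + s *: k) (w t); rewrite -(diff_F1 _ f_diff_s).
  by apply: DeriveDef; [exact: diff_derivable|rewrite deriveE].
have dh_le s : 0 <= s <= 1 -> `|dh s| <= e * `|k|.
  move=> /andP[s0 s1]; rewrite /dh -mulmxBl.
  apply: le_trans (mulmx_norm_le _ _) _; rewrite ler_wpM2r//.
  have : `|F1 f (a + s *: k) (w t) - J| <= e / (m%:R + 1).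
    apply: rP => //; rewrite addrAC subrr add0r normrZ ger0_norm//.
    by rewrite (le_trans _ zr)// ler_piMl.
  rewrite ler_pdivlMr// => H; rewrite mulrC (le_trans _ H)//.
  by rewrite ler_wpM2l// lerDl.
have := mean_value_inequality (x := 0) _ h_der dh_le.
rewrite lexx ler01 => /(_ isT 1); rewrite ler01 lexx => /(_ isT).
rewrite /h !scale1r !scale0r addr0 !subr0 normr1 mulr1.
by rewrite /k (addrC a) subrK addrAC.
Qed.

Lemma bounded_along n (A : R -> 'M[R]_(m, n)) (p q : R) :
  {within `[p, q], continuous A} ->
  exists2 L : R, 0 <= L & forall t k (v : 'M[R]_(n, k)), p <= t <= q ->
    `|A t *m v| <= L * `|v|.
Proof.
move=> cA; have /compact_bounded[M [_ MP]] :=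
  continuous_compact cA (@segment_compact R p q).
exists (n%:R * (`|M| + 1)); first by rewrite mulr_ge0.
move=> t k v tpq; apply: le_trans (mulmx_norm_le _ _) _.
rewrite ler_wpM2r// ler_wpM2l//; apply: MP; last by exists t => //=; rewrite in_itv.
by rewrite (le_lt_trans (ler_norm M))// ltrDl.
Qed.

End jacobian_along.

(** * Dependence of solutions on their value at one point *)

Section perturbation.
Context {R : realType} {m : nat}.
Variables (p q L : R) (A : R -> 'M[R]_m).
Hypothesis L0 : 0 <= L.
Hypothesis A_le : forall t k (v : 'M[R]_(m, k)), p <= t <= q ->
  `|A t *m v| <= L * `|v|.

Lemma linear_gronwall k (x eps : R) (e de : R -> 'M[R]_(m, k)) :
  p <= x <= q -> 0 <= eps ->
  (forall t, p <= t <= q -> is_derive_within `[p, q] t e (de t)) ->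
  (forall t, p <= t <= q -> `|de t - A t *m e t| <= eps) ->
  forall t, p <= t <= q ->
    `|e t| <= (`|e x| + eps) * expR ((L + 1) * (q - p)).
Proof.
move=> xpq eps0 e_der de_le.
apply: (@gronwall _ _ p q x L `|e x| eps
  ((`|e x| + eps) * expR ((L + 1) * (q - p)) + 1) e de) => //.
  by rewrite ltrDl.
move=> t tpq _; rewrite -(subrK (A t *m e t) (de t)) addrC.
by rewrite (le_trans (ler_normD _ _))// lerD ?A_le ?de_le.
Qed.

Hypothesis A_cont : {within `[p, q], continuous A}.

(** By Gronwall, solutions up to errors a and b with the same value at x differ
    by O(a + b), so they converge uniformly as the error goes to 0. The limit v
    is differentiable with derivative A v because the derivatives of all
    sufficiently accurate approximate solutions are close to A t *m v t on one
    and the same neighbourhood of t. *)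
Lemma linear_solution_of_approximate k (x : R) (v0 : 'M[R]_(m, k)) :
  p <= x <= q ->
  (forall eps : R, 0 < eps -> exists e de : R -> 'M[R]_(m, k), [/\
    forall t, p <= t <= q -> is_derive_within `[p, q] t e (de t),
    forall t, p <= t <= q -> `|de t - A t *m e t| <= eps & e x = v0]) ->
  exists2 v : R -> 'M[R]_(m, k), v x = v0 &
    forall t, p <= t <= q -> is_derive_within `[p, q] t v (A t *m v t).
Proof.
move=> xpq approx.
have {approx}/choice[D DP] : forall a : R, exists e : R -> 'M[R]_(m, k),
    0 < a -> e x = v0 /\ exists2 de : R -> 'M[R]_(m, k),
      forall t, p <= t <= q -> is_derive_within `[p, q] t e (de t) &
      forall t, p <= t <= q -> `|de t - A t *m e t| <= a.
  move=> a; have [a0|a0] := ltP 0 a; last by exists 0.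
  by have [e [de [? ? ?]]] := approx a a0; exists e => _; split=> //; exists de.
set C := expR ((L + 1) * (q - p)); have C0 : 0 < C by exact: expR_gt0.
have D_dist a b t : 0 < a -> 0 < b -> p <= t <= q ->
    `|D a t - D b t| <= (a + b) * C.
  move=> a0 b0 tpq; have [ax [da da_der da_le]] := DP a a0.
  have [bx [db db_der db_le]] := DP b b0.
  have := @linear_gronwall k x (a + b) (fun s => D a s - D b s)
    (fun s => da s - db s) xpq.
  rewrite ax bx subrr normr0 add0r; apply => //; first by rewrite ltW// addr_gt0.
    by move=> s spq; apply: is_derive_withinB; [exact: da_der|exact: db_der].
  move=> s spq; rewrite mulmxBr opprD addrACA -opprD.
  by rewrite (le_trans (ler_normB _ _))// lerD ?da_le ?db_le.
pose v t := lim (D a t @[a --> 0^'+]).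
have v_lim t : p <= t <= q -> D a t @[a --> 0^'+] --> v t.
  move=> tpq; apply/cauchy_cvgP/cauchy_exP => e e0.
  have b0 : 0 < e / (3 * C) by rewrite divr_gt0// mulr_gt0.
  exists (D (e / (3 * C)) t).
  suff : \forall a \near 0^'+, `|D (e / (3 * C)) t - D a t| < e.
    by rewrite -ball_normE.
  near=> a.
  have a0 : 0 < a by near: a; exact: nbhs_right_gt.
  apply: le_lt_trans (D_dist _ _ _ b0 a0 tpq) _.
  have ab : a <= e / (3 * C) by near: a; exact: nbhs_right_le.
  have bC : e / (3 * C) * C = e / 3 by field; rewrite gt_eqF.
  by rewrite mulrDl bC; have := ler_wpM2r (ltW C0) ab; rewrite bC; lra.
have v_dist a t : 0 < a -> p <= t <= q -> `|v t - D a t| <= 2 * a * C.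
  move=> a0 tpq; apply/ler_addgt0Pr => e e0.
  have /cvgrPdist_le/(_ _ e0) near_v := v_lim t tpq.
  near (0 : R)^'+ => b.
  have b0 : 0 < b by near: b; exact: nbhs_right_gt.
  have ba : b <= a by near: b; exact: nbhs_right_le.
  have vb : `|v t - D b t| <= e by near: b.
  rewrite -(subrK (D b t) (v t)) -addrA (le_trans (ler_normD _ _))//.
  rewrite [leRHS]addrC lerD//; apply: le_trans (D_dist b a t b0 a0 tpq) _.
  by rewrite ler_wpM2r ?(ltW C0)//; lra.
exists v.
  apply/subr0_eq/normr0_eq0/eqP; rewrite eq_le normr_ge0 andbT.
  apply/ler_addgt0Pr => e e0; rewrite add0r.
  have a0 : 0 < e / (2 * C) by rewrite divr_gt0// mulr_gt0.
  have := v_dist _ x a0 xpq; rewrite (DP _ a0).1 => /le_trans; apply.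
  by rewrite le_eqVlt; apply/orP; left; apply/eqP; field; rewrite gt_eqF.
move=> t tpq; apply/is_derive_withinP => e e0.
have [/= L1 LC] : 0 < L + 1 /\ 0 < 1 + 4 * L * C.
  by split; [rewrite ltr_wpDl|rewrite ltr_pwDl// !mulr_ge0// ltW].
(* For b <= a, the defect of D b is at most a, and A *m (D b - v t) is at most
   4 L C a plus L times the variation of D a; hence a + 4 L C a = e / 4. *)
pose a := e / (4 * (1 + 4 * L * C)).
have a0 : 0 < a by rewrite divr_gt0// mulr_gt0.
have aE : a + 4 * L * C * a = e / 4 by rewrite /a; field; rewrite gt_eqF.
have e10 : 0 < e / (4 * (L + 1)) by rewrite divr_gt0// mulr_gt0.
have e20 : 0 < e / 4 / (m%:R * `|v t| + 1).
  by rewrite !divr_gt0// ltr_wpDl// mulr_ge0.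
have tI : `[p, q]%classic t by rewrite /= in_itv.
have [_ [da da_der _]] := DP a a0.
have [d1 d10 d1P] := is_derive_within_dist_le tI (da_der t tpq) e10.
have [d2 d20 d2P] : exists2 d : R, 0 < d & forall s, p <= s <= q ->
    `|s - t| < d -> `|A t - A s| <= e / 4 / (m%:R * `|v t| + 1).
  have /subspace_continuousP/(_ t tI)/cvgrPdist_le/(_ _ e20) := A_cont.
  rewrite near_withinE => /nbhs_normP[d /= d0 dP]; exists d => // s spq st.
  by apply: dP; rewrite /= ?in_itv// distrC.
exists (Num.min d1 d2); first by rewrite lt_min d10.
move=> s; rewrite /= in_itv /= lt_min => spq /andP[sd1 sd2].
(* Uniform in b: the neighbourhood of t is fixed before b goes to 0. *)
have der_near b db r : 0 < b -> b <= a -> p <= r <= q -> `|r - t| <= `|s - t| ->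
    `|db - A r *m D b r| <= b -> `|db - A t *m v t| <= e.
  move=> b0 ba rpq rt db_le.
  have Dr : `|D b r - v t| <= 4 * a * C + e / (4 * (L + 1)).
    have H1 := D_dist b a r b0 a0 rpq.
    have rI : `[p, q]%classic r by rewrite /= in_itv.
    have H2 := d1P r rI (le_lt_trans rt sd1).
    have H3 := v_dist a t a0 tpq; rewrite distrC in H3.
    have -> : D b r - v t = (D b r - D a r) + (D a r - D a t) + (D a t - v t).
      by rewrite !addrA !subrK.
    apply: le_trans (ler_normD _ _) _.
    apply: le_trans (lerD (ler_normD _ _) H3) _.
    have bC : b * C <= a * C by rewrite ler_wpM2r// ltW.
    by lra.
  have -> : db - A t *m v t = (db - A r *m D b r) + A r *m (D b r - v t)
      + (A r - A t) *m v t.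
    by rewrite mulmxBr mulmxBl !addrA !subrK.
  apply: le_trans (ler_normD _ _) _.
  apply: le_trans (lerD (ler_normD _ _) (mulmx_norm_le _ _)) _.
  have H1 := le_trans (A_le (D b r - v t) rpq) (ler_wpM2l L0 Dr).
  have H2 := d2P r rpq (le_lt_trans rt sd2); rewrite distrC in H2.
  have H3 : m%:R * `|A r - A t| * `|v t| <= e / 4.
    rewrite mulrAC (le_trans (ler_wpM2l _ H2))// ?mulr_ge0//.
    rewrite mulrA ler_pdivrMr ?ltr_wpDl ?mulr_ge0//.
    by rewrite mulrC ler_wpM2l ?lerDl// divr_ge0// ltW.
  have H4 : L * (e / (4 * (L + 1))) <= e / 4.
    rewrite mulrA ler_pdivrMr ?mulr_gt0//.
    by have := mulr_ge0 L0 (ltW e0); lra.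
  by rewrite mulrDr in H1; lra.
apply/ler_addgt0Pr => k0 k0_gt0.
have [b [b0 ba bk]] : exists b : R, [/\ 0 < b, b <= a & 4 * b * C <= k0].
  exists (Num.min a (k0 / (4 * C))).
  rewrite lt_min a0 divr_gt0 ?mulr_gt0// ge_min lexx; split => //.
  by rewrite mulrAC mulrC -ler_pdivlMr ?mulr_gt0// ge_min lexx orbT.
have [_ [db db_der db_le]] := DP b b0.
have := @mean_value_inequality _ _ (Num.min s t) (Num.max s t) t e
  (fun r => D b r - r *: (A t *m v t)) (fun r => db r - A t *m v t).
have between r : Num.min s t <= r <= Num.max s t ->
    p <= r <= q /\ `|r - t| <= `|s - t|.
  move: spq tpq => /andP[? ?] /andP[? ?]; case: (leP s t) => st /andP[? ?].
    by split; [lra|rewrite !ler0_norm; lra].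
  by split; [lra|rewrite !ger0_norm; lra].
rewrite ge_min le_max !lexx !orbT => /(_ isT) MV.
have {MV} : `|D b s - D b t - (s - t) *: (A t *m v t)| <= e * `|s - t|.
  have -> : D b s - D b t - (s - t) *: (A t *m v t) =
      D b s - s *: (A t *m v t) - (D b t - t *: (A t *m v t)).
    by rewrite scalerBl !opprB addrACA [RHS]addrACA [- D b t + _]addrC.
  apply: MV; last by rewrite ge_min le_max !lexx.
    move=> r /between[rpq _]; apply: is_derive_withinB.
      apply: is_derive_within_subset (db_der r rpq).
      by move=> r' /=; rewrite !in_itv => /between[].
    apply: (is_derive_within_ext (u := fun r' => 0 + r' *: (A t *m v t))).
      by move=> r'; rewrite add0r.
    exact: is_derive_within_affine.
  by move=> r /between[rpq rt]; exact: der_near (db_le r rpq).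
have Hs := v_dist b s b0 spq; have Ht := v_dist b t b0 tpq.
have -> : v s - v t - (s - t) *: (A t *m v t) =
    (D b s - D b t - (s - t) *: (A t *m v t)) + ((v s - D b s) - (v t - D b t)).
  rewrite [RHS]addrAC; congr (_ - _).
  by rewrite opprB addrACA addKr (addrC (D b s)) subrK.
move=> H; apply: le_trans (ler_normD _ _) _; apply: lerD H _.
by apply: le_trans (ler_normB _ _) _; lra.
Unshelve. all: by end_near. Qed.


Variables (g : R -> 'cV[R]_m -> 'cV[R]_m) (u0 : R -> 'cV[R]_m).
Hypothesis linearization : forall e : R, 0 < e -> exists2 r : R, 0 < r &
  forall t z, p <= t <= q -> `|z - u0 t| <= r ->
  `|g t z - g t (u0 t) - A t *m (z - u0 t)| <= e * `|z - u0 t|.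

Definition integral_curve (u : R -> 'cV[R]_m) :=
  forall t, p <= t <= q -> is_derive_within `[p, q] t u (g t (u t)).

Hypothesis u0_sol : integral_curve u0.

(** A solution u close to u0 at one point x stays, by Gronwall, in the region
    where the linearization is accurate, and its distance to u0 remains
    comparable to the distance at x. The radius does not depend on x; this
    matters when the base point itself moves. *)
Lemma linearization_error (eps : R) : 0 < eps -> exists2 r : R, 0 < r &
  forall x u, p <= x <= q -> integral_curve u -> `|u x - u0 x| < r ->
  forall t, p <= t <= q ->
    `|g t (u t) - g t (u0 t) - A t *m (u t - u0 t)| <= eps * `|u x - u0 x|.
Proof.
move=> eps0; set C := expR ((L + 1 + 1) * (q - p)).
have C0 : 0 < C by exact: expR_gt0.
have k0 : 0 < Num.min 1 (eps / C) by rewrite lt_min ltr01 divr_gt0.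
have [r r0 rP] := linearization k0.
(* Gronwall is applied with the constant L + 1: linearization to accuracy at
   most 1 makes g Lipschitz near u0 with this constant. *)
exists (r / C); first exact: divr_gt0.
move=> x u xpq u_sol; rewrite ltr_pdivlMr// => uxr.
have u_le : forall t, p <= t <= q -> `|u t - u0 t| <= `|u x - u0 x| * C.
  rewrite -[`|u x - u0 x|]addr0.
  apply: (@gronwall _ _ p q x (L + 1) `|u x - u0 x| 0 r
    (fun t => u t - u0 t) (fun t => g t (u t) - g t (u0 t))) => //.
  - by rewrite addr_ge0.
  - by rewrite addr0.
  - by move=> t tpq; apply: is_derive_withinB; [exact: u_sol|exact: u0_sol].
  move=> t tpq ut; rewrite addr0 mulrDl mul1r [leRHS]addrC.
  rewrite -(subrK (A t *m (u t - u0 t)) (g t (u t) - _)).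
  apply: le_trans (ler_normD _ _) _; apply: lerD (A_le _ tpq).
  apply: le_trans (rP _ _ tpq ut) _.
  by rewrite -[leRHS]mul1r ler_wpM2r// ge_min lexx.
move=> t tpq; have ut := u_le t tpq.
apply: le_trans (rP _ _ tpq (le_trans ut (ltW uxr))) _.
apply: (@le_trans _ _ (eps / C * (`|u x - u0 x| * C))).
  by rewrite ler_pM// ?(ltW k0)// ge_min lexx orbT.
by rewrite mulrCA mulrC divfK ?gt_eqF// mulrC.
Qed.

(** The remainder u - u0 - v solves the linear equation up to the linearization
    error. Leaving both x and v x free is what makes one estimate serve the
    derivative in the value and the derivative in the base point. *)
Lemma first_order_perturbation (eps : R) : 0 < eps ->
  exists2 r : R, 0 < r & forall x u v, p <= x <= q -> integral_curve u ->
  (forall t, p <= t <= q -> is_derive_within `[p, q] t v (A t *m v t)) ->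
  `|u x - u0 x| < r ->
  forall t, p <= t <= q -> `|u t - u0 t - v t| <=
    (`|u x - u0 x - v x| + eps * `|u x - u0 x|) * expR ((L + 1) * (q - p)).
Proof.
move=> /linearization_error[r r0 rP]; exists r => // x u v xpq u_sol v_sol uxr.
apply: (@linear_gronwall _ _ _ (fun t => u t - u0 t - v t)
  (fun t => g t (u t) - g t (u0 t) - A t *m v t)) => //.
- exact: le_trans (rP x u xpq u_sol uxr x xpq).
- move=> t tpq; apply: is_derive_withinB (v_sol t tpq).
  by apply: is_derive_withinB; [exact: u_sol|exact: u0_sol].
- move=> t tpq; rewrite mulmxBr opprB addrA subrK.
  exact: rP.
Qed.

Section fundamental_matrix.
Variables (xi : R) (Y : R -> 'cV[R]_m -> 'cV[R]_m).
Hypothesis xi_in : p <= xi <= q.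
Hypothesis Y_sol :
  \forall z \near u0 xi, integral_curve (Y^~ z) /\ Y xi z = z.

(** The difference quotient h^-1 (Y t (u0 xi + h v0) - u0 t) takes the value v0
    at xi and solves the linear equation up to an error that tends to 0
    with h. *)
Lemma exists_linear_solution (v0 : 'cV[R]_m) :
  exists2 v : R -> 'cV[R]_m, v xi = v0 &
    forall t, p <= t <= q -> is_derive_within `[p, q] t v (A t *m v t).
Proof.
apply: linear_solution_of_approximate => // eps eps0.
have c0 : 0 < `|v0| + 1 by rewrite ltr_wpDl.
have [r r0 rP] := linearization_error (divr_gt0 eps0 c0).
have [d /= d0 dP] := (nbhs_normP _ _).1 Y_sol.
have m0 : 0 < Num.min r d by rewrite lt_min r0.
pose h := Num.min r d / (`|v0| + 1); have h0 : 0 < h by rewrite divr_gt0.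
have hv : `|h *: v0| < Num.min r d.
  rewrite normrZ gtr0_norm// /h mulrAC ltr_pdivrMr// ltr_pM2l//.
  by rewrite ltrDl.
have [u_sol uE] : integral_curve (Y^~ (u0 xi + h *: v0)) /\
    Y xi (u0 xi + h *: v0) = u0 xi + h *: v0.
  apply: dP; rewrite /= opprD addrA subrr add0r normrN (lt_le_trans hv)//.
  by rewrite ge_min lexx orbT.
have uB : Y xi (u0 xi + h *: v0) - u0 xi = h *: v0.
  by rewrite uE addrAC subrr add0r.
set u := Y^~ (u0 xi + h *: v0) in u_sol.
exists (fun t => h^-1 *: (u t - u0 t)),
  (fun t => h^-1 *: (g t (u t) - g t (u0 t))); split.
- move=> t tpq; apply: (@is_derive_within_linear _ _ _ ( *:%R h^-1) _ _
    (fun s => u s - u0 s)); first by move=> z; exact: scaler_continuous.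
  by apply: is_derive_withinB; [exact: u_sol|exact: u0_sol].
- move=> t tpq; rewrite -scalemxAr -scalerBr normrZ gtr0_norm ?invr_gt0//.
  have := rP xi u xi_in u_sol; rewrite /u uB => /(_ _ t tpq) H.
  rewrite mulrC ler_pdivrMr//; apply: le_trans (H _) _.
    by rewrite (lt_le_trans hv)// ge_min lexx.
  rewrite normrZ gtr0_norm// mulrAC ler_pdivrMr// -mulrA ler_wpM2l ?(ltW eps0)//.
  by rewrite ler_wpM2l ?(ltW h0)// lerDl.
- by rewrite /u uB scalerK// gt_eqF.
Qed.

Lemma exists_fundamental_matrix :
  exists2 Phi : R -> 'M[R]_m, Phi xi = 1%:M & forall t, p <= t <= q ->
    is_derive_within `[p, q] t Phi (A t *m Phi t).
Proof.
have /choice[v vP] : forall j : 'I_m, exists v : R -> 'cV[R]_m,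
    v xi = delta_mx j 0 /\ forall t, p <= t <= q ->
    is_derive_within `[p, q] t v (A t *m v t).
  by move=> j; have [v] := exists_linear_solution (delta_mx j 0); exists v.
exists (fun t => \sum_j v j t *m delta_mx 0 j).
  rewrite mx1_sum_delta; apply: eq_bigr => j _.
  by rewrite (vP j).1 mul_delta_mx.
move=> t tpq; rewrite mulmx_sumr; apply: is_derive_within_sum => j.
rewrite mulmxA; apply: (@is_derive_within_linear _ _ _
  (mulmxr (delta_mx 0 j)) _ _ (v j)); first exact: continuous_mulmxr.
exact: (vP j).2.
Qed.

End fundamental_matrix.

Section at_base_point.
Variables (xi : R) (Phi : R -> 'M[R]_m).
Hypothesis xi_in : p <= xi <= q.
Hypothesis Phi_der : forall t, p <= t <= q ->
  is_derive_within `[p, q] t Phi (A t *m Phi t).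
Hypothesis Phi_xi : Phi xi = 1%:M.

Lemma fundamental_column (v : 'cV[R]_m) t : p <= t <= q ->
  is_derive_within `[p, q] t (fun s => Phi s *m v) (A t *m (Phi t *m v)).
Proof.
move=> tpq; rewrite mulmxA.
apply: (@is_derive_within_linear _ _ _ (mulmxr v) _ _ Phi); last exact: Phi_der.
exact: continuous_mulmxr.
Qed.

(** Compared at xi, the solution through u0 xi + k and u0 + Phi k agree
    exactly. *)
Lemma is_diff_value (Y : R -> 'cV[R]_m -> 'cV[R]_m) t :
  (\forall z \near u0 xi, integral_curve (Y^~ z) /\ Y xi z = z) ->
  Y^~ (u0 xi) =1 u0 -> p <= t <= q ->
  is_diff (u0 xi) (Y t) (fun v => Phi t *m v).
Proof.
move=> Y_sol Y0 tpq.
apply: (@is_diff_of_bound _ _ _ _ (mulmx (Phi t))); first exact: continuous_mulmx.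
move=> e e0; set C := expR ((L + 1) * (q - p)).
have C0 : 0 < C by exact: expR_gt0.
have [r r0 rP] := first_order_perturbation (divr_gt0 e0 C0).
near=> k.
have [k_sol kE] : integral_curve (Y^~ (u0 xi + k)) /\
    Y xi (u0 xi + k) = u0 xi + k.
  by near: k; exact: ((nbhs0P _ _).1 Y_sol).
have := rP xi _ (fun s => Phi s *m k) xi_in k_sol.
rewrite kE [u0 xi + k]addrC addrK Phi_xi mul1mx subrr normr0 add0r.
rewrite mulrAC divfK ?gt_eqF// addrC Y0; apply => //.
  by move=> s; exact: fundamental_column.
Unshelve. all: by end_near. Qed.

(** Comparing at the moving point x makes the value Y x x = u0 xi
    available. *)
Lemma is_derive_base_point (Y : R -> R -> 'cV[R]_m) t :
  (forall x, p <= x <= q -> integral_curve (Y^~ x) /\ Y x x = u0 xi) ->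
  Y^~ xi =1 u0 -> p <= t <= q ->
  is_derive_within `[p, q] xi (Y t) (- (Phi t *m g xi (u0 xi))).
Proof.
move=> Y_sol Y0 tpq; apply/is_derive_withinP => e e0.
set C := expR ((L + 1) * (q - p)); have C0 : 0 < C by exact: expR_gt0.
set v := g xi (u0 xi).
pose k := e / (4 * C); have k0 : 0 < k by rewrite divr_gt0// mulr_gt0.
have kC : k * C = e / 4 by rewrite /k; field; rewrite gt_eqF.
have c0 : 0 < k + `|v| by rewrite ltr_pwDl.
have [r r0 rP] := first_order_perturbation (divr_gt0 k0 c0).
have inI s : p <= s <= q -> `[p, q]%classic s by rewrite /= in_itv.
have r20 : 0 < r / 2 by lra.
have [d1 d10 d1P] := is_derive_within_dist_le (inI _ xi_in) (u0_sol xi_in) r20.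
have [d2 d20 d2P] := (is_derive_withinP _ _ _ _).1 (u0_sol xi_in) k k0.
have [d3 d30 d3P] :=
  is_derive_within_dist_le (inI _ xi_in) (fundamental_column (v := v) xi_in) k0.
exists (Num.min d1 (Num.min d2 d3)); first by rewrite !lt_min d10 d20.
move=> x; rewrite /= in_itv !lt_min => xpq /and3P[xd1 xd2 xd3].
have [x_sol xE] := Y_sol x xpq.
have {}d1P := d1P x (inI x xpq) xd1.
have := d2P x (inI x xpq) xd2; set o := u0 x - _ - _ => o_le.
have {}d3P := d3P x (inI x xpq) xd3; rewrite Phi_xi mul1mx in d3P.
have u0x : `|u0 xi - u0 x| <= (k + `|v|) * `|x - xi|.
  have -> : u0 xi - u0 x = - (o + (x - xi) *: v) by rewrite subrK opprB.
  rewrite normrN (le_trans (ler_normD _ _))// normrZ mulrDl.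
  by rewrite lerD// mulrC.
have := rP x _ (fun s => - (x - xi) *: (Phi s *m v)) xpq x_sol.
rewrite xE => /(_ _ _ t tpq) H.
rewrite scalerN -scaleNr Y0; apply: le_trans (H _ _) _.
- move=> s spq; rewrite -scalemxAr.
  apply: (@is_derive_within_linear _ _ _ ( *:%R (- (x - xi))) _ _
    (fun s => Phi s *m v)); last exact: fundamental_column.
  by move=> z; apply: scaler_continuous.
- by rewrite distrC; apply: le_lt_trans d1P _; lra.
have Hx : `|u0 xi - u0 x - - (x - xi) *: (Phi x *m v)| <= 2 * k * `|x - xi|.
  have -> : u0 xi - u0 x - - (x - xi) *: (Phi x *m v) =
      (x - xi) *: (Phi x *m v - v) - o.
    rewrite /o scalerBr scaleNr opprK (opprB _ (_ *: v)) addrA subrK.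
    by rewrite opprB addrC.
  rewrite (le_trans (ler_normB _ _))// normrZ.
  have : `|x - xi| * `|Phi x *m v - v| <= `|x - xi| * k by rewrite ler_wpM2l.
  by lra.
have He : k / (k + `|v|) * `|u0 xi - u0 x| <= k * `|x - xi|.
  by rewrite mulrAC -mulrA ler_wpM2l ?(ltW k0)// ler_pdivrMr// mulrC.
apply: (@le_trans _ _ (3 * k * `|x - xi| * C)).
  by rewrite ler_wpM2r ?(ltW C0)//; lra.
rewrite mulrAC -(mulrA 3) kC ler_wpM2r//; lra.
Qed.

End at_base_point.

End perturbation.

(** * Delay equations on the first delay interval *)

Lemma continuous_within_shift (R : realType) (V : topologicalType)
    (phi : R -> V) (p q tau : R) :
  {within `[p - tau, q - tau], continuous phi} ->
  {within `[p, q], continuous (fun t => phi (t - tau))}.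
Proof.
move=> /subspace_continuousP phi_cont; apply/subspace_continuousP => t tpq.
have tpq' : `[p - tau, q - tau]%classic (t - tau).
  by move: tpq; rewrite /= !in_itv /= !lerD2r.
move=> B /(phi_cont _ tpq'); rewrite /= !nbhs_simpl /= /within /=.
move=> /nbhs_normP[d /= d0 dP]; apply/nbhs_normP; exists d => //= s sd spq.
apply: dP => /=; first by rewrite opprB addrA subrK.
by move: spq; rewrite !in_itv /= !lerD2r.
Qed.

Theorem theorem14 (R : realType) (m : nat)
    (f : 'cV[R]_m -> 'cV[R]_m -> 'cV[R]_m) (phi : R -> 'cV[R]_m)
    (t0 tau xi : R) (eta : 'cV[R]_m)
    (y : R -> R -> 'cV[R]_m -> 'cV[R]_m)
    (tau_gt0 : 0 < tau)
    (f_regular : regular_rhs f)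
    (phi_continuous : {within `[t0 - tau, t0], continuous phi})
    (xi_in : xi \in `[t0, t0 + tau])
    (y_solution : \forall eta' \near eta, forall xi', xi' \in `[t0, t0 + tau] ->
       dde_solution f phi t0 tau xi' eta' (fun t => y t xi' eta')) :
  (forall t, t \in `[t0, t0 + tau] ->
     is_derive_within `[t0, t0 + tau] t (fun s => y s xi eta)
       (f (y t xi eta) (phi (t - tau)))) /\
  (exists Phi : R -> 'M[R]_m,
     variational_solution f phi t0 tau xi (fun t => y t xi eta) Phi) /\
  (forall Phi : R -> 'M[R]_m,
     variational_solution f phi t0 tau xi (fun t => y t xi eta) Phi ->
     forall t, t \in `[t0 - tau, t0 + tau] ->
       is_diff eta (fun eta' => y t xi eta') (fun v => Phi t *m v) /\
       is_derive_within `[t0, t0 + tau] xi (fun xi' => y t xi' eta)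
         (- (Phi t *m f (y xi xi eta) (phi (xi - tau))))).
Proof.
have inP (t : R) : (t \in `[t0, t0 + tau]) = (t0 <= t <= t0 + tau).
  by rewrite in_itv.
have xi_in' := xi_in; rewrite inP in xi_in'.
pose w t := phi (t - tau); pose g t z := f z (w t).
pose u0 t := y t xi eta.
pose A t := F1 f (u0 t) (w t).
have y_eta := nbhs_singleton y_solution.
have y_sol x : t0 <= x <= t0 + tau ->
    integral_curve t0 (t0 + tau) g (fun t => y t x eta) /\ y x x eta = eta.
  by rewrite -inP => /y_eta[].
have [u0_sol u0_xi] := y_sol xi xi_in'.
have y_near : \forall z \near u0 xi,
    integral_curve t0 (t0 + tau) g (fun t => y t xi z) /\ y xi xi z = z.
  by rewrite /u0 u0_xi; apply: filterS y_solution => z /(_ xi xi_in)[].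
have w_cont : {within `[t0, t0 + tau], continuous w}.
  by apply: continuous_within_shift; rewrite addrK.
have u0_cont : {within `[t0, t0 + tau], continuous u0}.
  apply: is_derive_within_continuous => t.
  by rewrite /= inP; exact: u0_sol.
have A_cont : {within `[t0, t0 + tau], continuous A}.
  by case: f_regular => _ _ cF1; exact: (continuous_along cF1).
have [L L0 A_le] := bounded_along A_cont.
have lin := jacobian_linearization f_regular u0_cont w_cont.
split; first by move=> t; rewrite inP; exact: u0_sol.
split.
  have [Phi Phi_xi Phi_der] := @exists_fundamental_matrix _ _ _ _ _ _
    L0 A_le A_cont _ _ lin u0_sol _ _ xi_in' y_near.
  pose Psi t := if t0 <= t then Phi t else 0.
  have Psi_eq t : t0 <= t -> Psi t = Phi t by rewrite /Psi => ->.
  exists Psi; split.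
  - move=> t; rewrite inP => tin; rewrite Psi_eq; last by case/andP: tin.
    apply: (is_derive_within_eq _ _ (Phi_der t tin)); first by rewrite /= inP.
    by move=> s; rewrite inE /= inP => /andP[/Psi_eq].
  - by rewrite Psi_eq//; case/andP: xi_in'.
  - by move=> t; rewrite in_itv /= => /andP[_]; rewrite /Psi ltNge; case: leP.
move=> Phi [Phi_der Phi_xi Phi0] t.
have [t0t|tt0] := leP t0 t; last first.
  rewrite in_itv /= => /andP[tt _].
  have t_mem : t \in `[t0 - tau, t0[ by rewrite in_itv /= tt.
  have Phi_t := Phi0 t t_mem.
  have y_phi z : (forall xi', xi' \in `[t0, t0 + tau] ->
      dde_solution f phi t0 tau xi' z (fun t => y t xi' z)) ->
      forall x, x \in `[t0, t0 + tau] -> y t x z = phi t.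
    by move=> z_sol x /z_sol[_ _]; exact.
  rewrite Phi_t; split.
    apply: (@is_diff_of_bound _ _ _ _ (mulmx 0)); first exact: continuous_mulmx.
    move=> e e0; apply: filterS ((nbhs0P _ _).1 y_solution) => k k_sol.
    rewrite (y_phi _ k_sol xi xi_in) (y_phi _ y_eta xi xi_in) subrr sub0r.
    by rewrite normrN /= mul0mx normr0 mulr_ge0// ltW.
  rewrite mul0mx oppr0; apply: (is_derive_within_eq (u := fun=> phi t)).
  - by rewrite /= inP.
  - by move=> x; rewrite inE /= => /(y_phi _ y_eta).
  - exact: is_derive_within_cst.
rewrite in_itv /= => /andP[_ t_le]; have tin : t0 <= t <= t0 + tau by rewrite t0t.
have {}Phi_der s : t0 <= s <= t0 + tau ->
    is_derive_within `[t0, t0 + tau] s Phi (A s *m Phi s).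
  by rewrite -inP; exact: Phi_der.
split.
  rewrite -u0_xi; apply: (@is_diff_value _ _ _ _ _ _ L0 A_le _ _ lin u0_sol _ _
    xi_in' Phi_der Phi_xi (fun t z => y t xi z)) => //.
  by move=> s; rewrite /u0 u0_xi.
apply: (@is_derive_base_point _ _ _ _ _ _ L0 A_le _ _ lin u0_sol _ _
    xi_in' Phi_der Phi_xi (fun t x => y t x eta)) => //.
by move=> x xin; rewrite /u0 u0_xi; exact: y_sol.
Qed.
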